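(* Let $X$ be a finite set with $n$ elements, let $\check r(x,y)=(\sigma_x(y),\tau_y(x))$ be an involutive, non-degenerate set-theoretic solution of the braid equation on $X$, let $r=\sum_{x,y\in X}e_{y,\sigma_x(y)}\otimes e_{x,\tau_y(x)}$ be the associated $n^2\times n^2$ matrix, and let $R(\lambda)=\lambda r+\mathcal{P}$ for $\lambda\in\mathbb{C}$. For $\eta\in X$ let $\mathbb{V}_\eta=\sum_{x\in X}e_{\sigma_\eta(x),x}$, regarded as group-like for the Yangian coproduct, i.e. $\Delta_Y(\mathbb{V}_\eta)=\mathbb{V}_\eta\otimes\mathbb{V}_\eta$, and let $\Delta(\mathbb{V}_\eta)=F^{-1}\Delta_Y(\mathbb{V}_\eta)F$ be the twisted coproduct. Then for every $\eta\in X$ and every $\lambda\in\mathbb{C}$ $$\Delta^{(op)}(\mathbb{V}_\eta)\,R(\lambda)=R(\lambda)\,\Delta(\mathbb{V}_\eta),$$ where $\Delta^{(op)}(\mathbb{V}_\eta)=\mathcal{P}\Delta(\mathbb{V}_\eta)\mathcal{P}$ and $$\Delta(\mathbb{V}_\eta)=\sum_{x,y\in X}e_{\sigma_\eta(x),x}\otimes e_{\sigma_{\tau_x(\eta)}(y),y}\Big|_{C_1=0},\qquad C_1=\sigma_{\sigma_\eta(x)}\big(\sigma_{\tau_x(\eta)}(y)\big)-\sigma_\eta\big(\sigma_x(y)\big).$$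
   Context: **Set-theoretic solutions.** $X$ is a finite set with $n$ elements. A map $\check r:X\times X\to X\times X$, $\check r(x,y)=(\sigma_x(y),\tau_y(x))$, is an involutive non-degenerate set-theoretic solution of the braid equation if all maps $\sigma_x,\tau_y:X\to X$ are bijections, $\check r^2=\mathrm{id}$, and $(\check r\times\mathrm{id})(\mathrm{id}\times\check r)(\check r\times\mathrm{id})=(\mathrm{id}\times\check r)(\check r\times\mathrm{id})(\mathrm{id}\times\check r)$. **Matrices.** $e_{x,y}$ ($x,y\in X$) is the $n\times n$ complex matrix unit with $(e_{x,y})_{z,w}=\delta_{x,z}\delta_{y,w}$, acting on $\mathbb{C}X\cong\mathbb{C}^n$. $\mathcal{P}=\sum_{x,y\in X}e_{x,y}\otimes e_{y,x}$ is the permutation operator. **Twist.** $F=\sum_{x\in X}e_{x,x}\otimes\mathbb{V}_x$ with $\mathbb{V}_x=\sum_{y\in X}e_{\sigma_x(y),y}$; $F$ is invertible. The twisted coproduct of an element $a$ is $\Delta(a)=F^{-1}\Delta_Y(a)F$. For the elements $\mathbb{V}_\eta$, $\Delta_Y(\mathbb{V}_\eta)$ simply means the matrix $\mathbb{V}_\eta\otimes\mathbb{V}_\eta$. **The constraint.** The notation $|_{C_1=0}$ means that the expression is taken subject to $\sigma_{\sigma_\eta(x)}(\sigma_{\tau_x(\eta)}(y))=\sigma_\eta(\sigma_x(y))$; this is one of the component identities of the set-theoretic braid equation, so it holds for all $\eta,x,y\in X$. *)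

(* Defs.v *)
From HB Require Import structures.
From mathcomp Require Import all_boot all_order all_algebra.
From mathcomp Require Import mathcomp_extra reals.
From mathcomp Require Import mxtens complex.

Set Implicit Arguments.
Unset Strict Implicit.
Unset Printing Implicit Defensive.

Import GRing.Theory.
Local Open Scope ring_scope.

Definition rcheck (X : finType) (sigma tau : X -> X -> X) (p : X * X) : X * X :=
  (sigma p.1 p.2, tau p.2 p.1).

Definition map12 (X : finType) (f : X * X -> X * X) (t : X * X * X) :
    X * X * X :=
  let: (x, y, z) := t in ((f (x, y)).1, (f (x, y)).2, z).

Definition map23 (X : finType) (f : X * X -> X * X) (t : X * X * X) :
    X * X * X :=
  let: (x, y, z) := t in (x, (f (y, z)).1, (f (y, z)).2).

Definition braid_equation (X : finType) (f : X * X -> X * X) : Prop :=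
  forall t : X * X * X,
    map12 f (map23 f (map12 f t)) = map23 f (map12 f (map23 f t)).

Definition nondegenerate (X : finType) (sigma tau : X -> X -> X) : Prop :=
  (forall x, bijective (sigma x)) /\ (forall y, bijective (tau y)).

Definition set_theoretic_solution (X : finType) (sigma tau : X -> X -> X) :
    Prop :=
  [/\ nondegenerate sigma tau, involutive (rcheck sigma tau)
    & braid_equation (rcheck sigma tau)].

(* Matrices on K X and K X (x) K X are indexed by 'I_#|X| and 'I_(#|X| * #|X|)
   through the enumeration of X; A *t B is the Kronecker product of mxtens. *)
Definition munit (K : fieldType) (X : finType) (x y : X) : 'M[K]_#|X| :=
  delta_mx (enum_rank x) (enum_rank y).

Definition flipmx (K : fieldType) (X : finType) : 'M[K]_(#|X| * #|X|) :=
  \sum_(x : X) \sum_(y : X) munit K x y *t munit K y x.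

Definition rmx (K : fieldType) (X : finType) (sigma tau : X -> X -> X) :
    'M[K]_(#|X| * #|X|) :=
  \sum_(x : X) \sum_(y : X)
    munit K y (sigma x y) *t munit K x (tau y x).

Definition Rmx (K : fieldType) (X : finType) (sigma tau : X -> X -> X)
    (lambda : K) : 'M[K]_(#|X| * #|X|) :=
  lambda *: rmx K sigma tau + flipmx K X.

Definition Vmx (K : fieldType) (X : finType) (sigma : X -> X -> X) (eta : X) :
    'M[K]_#|X| :=
  \sum_(x : X) munit K (sigma eta x) x.

Definition twist (K : fieldType) (X : finType) (sigma : X -> X -> X) :
    'M[K]_(#|X| * #|X|) :=
  \sum_(x : X) munit K x x *t Vmx K sigma x.

(* invmx A is a genuine inverse only for A \in unitmx. *)
Lemma twist_unitmx (K : fieldType) (X : finType) (sigma : X -> X -> X) :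
  (forall x, bijective (sigma x)) -> twist K sigma \in unitmx.
Proof.
move=> bij_sigma.
have munitM (x y z w : X) :
  munit K x y *m munit K z w = if y == z then munit K x w else 0.
  rewrite /munit mul_delta_mx_cond (inj_eq enum_rank_inj).
  by case: (y == z); rewrite ?mulr1n ?mulr0n.
have sum_munit : \sum_(x : X) munit K x x = 1%:M.
  rewrite [RHS]mx1_sum_delta (reindex (@enum_rank X)) //=.
  exact/onW_bij/enum_rank_bij.
have VW x : Vmx K sigma x *m (\sum_(y : X) munit K y (sigma x y)) = 1%:M.
  rewrite mulmx_suml -[RHS]sum_munit [RHS](reindex (sigma x)) /=; last first.
    exact/onW_bij/bij_sigma.
  apply: eq_bigr => y _; rewrite mulmx_sumr (bigD1 y) //= munitM eqxx.
  by rewrite big1 ?addr0 // => z /negPf zy; rewrite munitM eq_sym zy.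
suff /mulmx1_unit[] : twist K sigma *m
    (\sum_(x : X) munit K x x *t (\sum_(y : X) munit K y (sigma x y))) = 1%:M.
  by [].
rewrite mulmx_suml; transitivity
  (\sum_(x : X) munit K x x *t (1%:M : 'M[K]_#|X|)).
  apply: eq_bigr => x _; rewrite mulmx_sumr (bigD1 x) //= tensmx_mul munitM.
  rewrite eqxx VW big1 ?addr0 // => z /negPf zx.
  by rewrite tensmx_mul munitM eq_sym zx tens0mx.
apply/matrixP => i j.
case: (mxtens_indexP i) => i1 i2; case: (mxtens_indexP j) => j1 j2.
rewrite summxE; under eq_bigr do rewrite tensmxE.
rewrite -mulr_suml -summxE sum_munit !mxE (can_eq (@mxtens_indexK _ _)).
by rewrite xpair_eqE -natrM mulnb.
Qed.

Definition DeltaY_V (K : fieldType) (X : finType) (sigma : X -> X -> X)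
    (eta : X) : 'M[K]_(#|X| * #|X|) :=
  Vmx K sigma eta *t Vmx K sigma eta.

Definition Delta_V (K : fieldType) (X : finType) (sigma : X -> X -> X)
    (eta : X) : 'M[K]_(#|X| * #|X|) :=
  invmx (twist K sigma) *m DeltaY_V K sigma eta *m twist K sigma.

Definition Delta_op_V (K : fieldType) (X : finType) (sigma : X -> X -> X)
    (eta : X) : 'M[K]_(#|X| * #|X|) :=
  flipmx K X *m Delta_V K sigma eta *m flipmx K X.

(* Main.v *)
Require Import Defs.
From mathcomp Require Import all_boot all_order all_algebra.
From mathcomp Require Import reals.
From mathcomp Require Import mxtens complex.

Set Implicit Arguments.
Unset Strict Implicit.
Unset Printing Implicit Defensive.

Import GRing.Theory.
Local Open Scope ring_scope.

(* Every matrix in the statement is the linear extension [opmx f] of a self-map f of X * X,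
   and f |-> [opmx f] is multiplicative. With d (x, y) = (sigma_eta x, sigma_{tau_x eta} y),
   the first component of the braid equation on (eta, x, y) says that [opmx d] is the
   conjugate of [V_eta (x) V_eta] by the twist, and the first two together say that d
   commutes with the solution; since r is the flip composed with the solution, both terms
   of R(lambda) intertwine d with its opposite. *)

Definition pairunit (K : fieldType) (X : finType) (p q : X * X) :
    'M[K]_(#|X| * #|X|) :=
  munit K p.1 q.1 *t munit K p.2 q.2.

(** The argument of [f] is the column index and its value the row index, so that matrix products
    follow composition in the same order. *)
Definition opmx (K : fieldType) (X : finType) (f : X * X -> X * X) :
    'M[K]_(#|X| * #|X|) :=
  \sum_(p : X * X) pairunit K (f p) p.

Lemma munitM (K : fieldType) (X : finType) (x y z w : X) :
  munit K x y *m munit K z w = munit K x w *+ (y == z).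
Proof. by rewrite /munit mul_delta_mx_cond (inj_eq enum_rank_inj). Qed.

Lemma pairunitM (K : fieldType) (X : finType) (p q s t : X * X) :
  pairunit K p q *m pairunit K s t = pairunit K p t *+ (q == s).
Proof.
case: q s => [q1 q2] [s1 s2]; rewrite /pairunit tensmx_mul !munitM xpair_eqE.
by do 2!case: eqP => _ //=; rewrite ?mulr0n ?tens0mx ?tensmx0.
Qed.

Lemma opmxM (K : fieldType) (X : finType) (f g : X * X -> X * X) :
  opmx K f *m opmx K g = opmx K (f \o g).
Proof.
rewrite mulmx_sumr; apply: eq_bigr => q _.
(* Only the summand [p = g q] has a column index matching the row index of the right factor. *)
rewrite mulmx_suml (bigD1 (g q)) //= pairunitM eqxx big1 ?addr0 // => p /negPf gp.
by rewrite pairunitM gp.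
Qed.

Lemma eq_opmx (K : fieldType) (X : finType) (f g : X * X -> X * X) :
  f =1 g -> opmx K f = opmx K g.
Proof. by move=> fg; apply: eq_bigr => p _; rewrite fg. Qed.

Lemma sum_opmx (K : fieldType) (X : finType) (f g : X -> X -> X) :
  \sum_(x : X) \sum_(y : X) munit K (f x y) x *t munit K (g x y) y =
  opmx K (fun p => (f p.1 p.2, g p.1 p.2)).
Proof. by rewrite pair_bigA. Qed.

Lemma tensmx_sumr (K : fieldType) (m n p q : nat) (I : finType)
    (A : 'M[K]_(m, n)) (B : I -> 'M[K]_(p, q)) :
  A *t (\sum_i B i) = \sum_i (A *t B i).
Proof.
apply/matrixP => i j; rewrite mxE !summxE mulr_sumr.
by apply: eq_bigr => k _; rewrite mxE.
Qed.

Lemma tensmx_suml (K : fieldType) (m n p q : nat) (I : finType)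
    (A : I -> 'M[K]_(m, n)) (B : 'M[K]_(p, q)) :
  (\sum_i A i) *t B = \sum_i (A i *t B).
Proof.
apply/matrixP => i j; rewrite mxE !summxE mulr_suml.
by apply: eq_bigr => k _; rewrite mxE.
Qed.

Lemma flipmx_opmx (K : fieldType) (X : finType) :
  flipmx K X = opmx K (fun p => (p.2, p.1)).
(* The summand has column index [(y, x)], hence the exchange of sums before [sum_opmx]. *)
Proof. by rewrite /flipmx exchange_big (sum_opmx K (fun _ y => y) (fun x _ => x)). Qed.

Lemma twist_opmx (K : fieldType) (X : finType) (sigma : X -> X -> X) :
  twist K sigma = opmx K (fun p => (p.1, sigma p.1 p.2)).
Proof.
rewrite -(sum_opmx K (fun x _ => x)); apply: eq_bigr => x _; exact: tensmx_sumr.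
Qed.

Lemma DeltaY_V_opmx (K : fieldType) (X : finType) (sigma : X -> X -> X)
    (eta : X) :
  DeltaY_V K sigma eta = opmx K (fun p => (sigma eta p.1, sigma eta p.2)).
Proof.
rewrite -(sum_opmx K (fun x _ => sigma eta x) (fun _ y => sigma eta y)).
by rewrite /DeltaY_V tensmx_suml; apply: eq_bigr => x _; exact: tensmx_sumr.
Qed.

(** By definition r sends [rcheck (x, y)] to [(y, x)]; since [rcheck] is its own inverse, reindexing
    along it shows that r is the flip after [rcheck]. *)
Lemma rmx_opmx (K : fieldType) (X : finType) (sigma tau : X -> X -> X) :
  involutive (rcheck sigma tau) ->
  rmx K sigma tau = opmx K (fun p => (tau p.2 p.1, sigma p.1 p.2)).
Proof.
move=> rK; rewrite /rmx pair_bigA [RHS](reindex_inj (inv_inj rK)) /=.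
apply: eq_bigr => -[x y] _; rewrite /pairunit /=.
by have [-> ->] := rK (x, y).
Qed.

(** This is the constraint C_1 = 0. *)
Lemma braid_sigma (X : finType) (sigma tau : X -> X -> X) (eta x y : X) :
  braid_equation (rcheck sigma tau) ->
  sigma (sigma eta x) (sigma (tau x eta) y) = sigma eta (sigma x y).
Proof. by move=> /(_ (eta, x, y))[]. Qed.

Lemma braid_tau_sigma (X : finType) (sigma tau : X -> X -> X) (eta x y : X) :
  braid_equation (rcheck sigma tau) ->
  tau (sigma (tau x eta) y) (sigma eta x) =
  sigma (tau (sigma x y) eta) (tau y x).
Proof. by move=> /(_ (eta, x, y))[]. Qed.

Lemma Delta_V_opmx (K : fieldType) (X : finType) (sigma tau : X -> X -> X)
    (eta : X) :
  (forall x, bijective (sigma x)) -> braid_equation (rcheck sigma tau) ->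
  Delta_V K sigma eta =
  opmx K (fun p => (sigma eta p.1, sigma (tau p.1 eta) p.2)).
Proof.
move=> bij_sigma braid; rewrite /Delta_V -mulmxA.
(* Cancelling the invertible twist F leaves V_eta (x) V_eta F = F [opmx d], an equality of self-maps
   of [X * X]; only its second coordinate needs the braid equation. *)
apply: (canLR (mulKmx (twist_unitmx K bij_sigma))).
rewrite DeltaY_V_opmx twist_opmx !opmxM; apply: eq_opmx => -[x y] /=.
by rewrite (braid_sigma _ _ _ braid).
Qed.

Theorem proposition2p5 (R : realType) (X : finType) (sigma tau : X -> X -> X)
    (hsol : set_theoretic_solution sigma tau) (eta : X) (lambda : R[i]) :
  [/\ Delta_op_V R[i] sigma eta *m Rmx sigma tau lambda
        = Rmx sigma tau lambda *m Delta_V R[i] sigma eta,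
      (forall x y : X,
         sigma (sigma eta x) (sigma (tau x eta) y) = sigma eta (sigma x y))
    & Delta_V R[i] sigma eta
        = \sum_(x : X) \sum_(y : X)
            munit R[i] (sigma eta x) x *t munit R[i] (sigma (tau x eta) y) y].
Proof.
have [[bij_sigma _] rK braid] := hsol.
split; last 2 first.
- by move=> x y; exact: (braid_sigma _ _ _ braid).
- by rewrite (Delta_V_opmx _ _ bij_sigma braid)
    (sum_opmx _ (fun x _ => sigma eta x) (fun x y => sigma (tau x eta) y)).
rewrite /Delta_op_V /Rmx (Delta_V_opmx _ _ bij_sigma braid) flipmx_opmx.
rewrite (rmx_opmx _ rK) mulmxDr mulmxDl -scalemxAr -scalemxAl !opmxM.
(* The flip term holds by computation, the flip being an involution. The [lambda] term reduces to d
   commuting with [rcheck], one braid component per coordinate. *)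
congr (_ *: _ + _); apply: eq_opmx => -[x y] //=.
by rewrite (braid_sigma _ _ _ braid) (braid_tau_sigma _ _ _ braid).
Qed.
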